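(* Let $\Omega\subset\mathbb{R}^n$ be an open, bounded and definable set and let $f\colon\overline{\Omega}\to\mathbb{R}^n$ be a continuous definable mapping. If $\overline{x}\in\Omega$ is a regular point of $f$, then there exists a scalar $r>0$ such that $\mathbb{B}_r(\overline{x})\subset\Omega$, every point of $\mathbb{B}_r(\overline{x})$ is a regular point of $f$, and $$\mathrm{Sign}_f(x)=\mathrm{Sign}_f(\overline{x})\quad\text{for all } x\in\mathbb{B}_r(\overline{x}).$$
   Context: Fix an o-minimal structure on $(\mathbb{R},+,\cdot)$, i.e. a sequence $(\mathcal{D}_n)_{n\in\mathbb{N}}$ such that: (a) $\mathcal{D}_n$ is a Boolean algebra of subsets of $\mathbb{R}^n$; (b) $X\in\mathcal{D}_m$, $Y\in\mathcal{D}_n$ imply $X\times Y\in\mathcal{D}_{m+n}$; (c) if $X\in\mathcal{D}_{n+1}$ then $\pi(X)\in\mathcal{D}_n$, where $\pi\colon\mathbb{R}^{n+1}\to\mathbb{R}^n$ is the projection on the first $n$ coordinates; (d) $\mathcal{D}_n$ contains all algebraic subsets of $\mathbb{R}^n$; (e) each set in $\mathcal{D}_1$ is a finite union of points and intervals. A set is definable if it belongs to some $\mathcal{D}_n$; a mapping is definable if its graph is definable. $\mathbb{B}_r(x)$ is the open Euclidean ball of center $x$ and radius $r$; $\mathrm{co}$ denotes convex hull. For $A\in\mathbb{R}^{n\times n}$, $\sigma(A):=\inf_{\|v\|=1}\|Av\|$. $B_f$ is the set of points of $\Omega$ at which $f$ is not of class $C^1$ (i.e. $f$ is not $C^1$ on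 any neighbourhood of the point); it is a definable nowhere dense set. For $x\in\Omega\setminus B_f$, $df(x)$ is the derivative of $f$ at $x$; for $U\subset\Omega$, $df(U):=\{df(x): x\in U\setminus B_f\}$. For $x\in\Omega$, $$\nu_f(x):=\lim_{r\to0^+}\ \inf_{A\in\mathrm{co}(df(\mathbb{B}_r(x)))}\sigma(A)\in[0,+\infty].$$ A point $x\in\Omega$ is a regular point of $f$ if $\nu_f(x)>0$. For a regular point $\overline{x}\in\Omega$ of $f$, $$\mathrm{Sign}_f(\overline{x}):=\lim_{x\in\Omega\setminus B_f,\ x\to\overline{x}}\mathrm{sign}\det df(x)$$ (this limit exists at regular points). *)

(* Defs.v *)
From mathcomp Require Import all_boot all_order all_algebra.
From mathcomp Require Import all_classical all_reals all_analysis.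
(* Not imported: the notations of mpoly clash with those of all_analysis. *)
From mathcomp Require mpoly.

Set Implicit Arguments.
Unset Strict Implicit.
Unset Printing Implicit Defensive.

Import Order.TTheory GRing.Theory Num.Theory.
Import numFieldNormedType.Exports.

Local Open Scope classical_set_scope.
Local Open Scope ring_scope.

Section OMinimal.
Variable R : realType.

Definition algebraic_set n (X : set 'rV[R]_n) :=
  exists P : set (mpoly.mpoly n R),
    X = [set x | forall p, P p -> mpoly.meval (x ord0) p = 0].

Record ominimal (D : forall n, set (set 'rV[R]_n)) : Prop := {
  ominimal_set0 n : D n set0;
  ominimal_setU n : setU_closed (D n);
  ominimal_setC n : setC_closed (D n);
  ominimal_prod m n (X : set 'rV[R]_m) (Y : set 'rV[R]_n) :
    D m X -> D n Y -> D (m + n)%N [set z | X (lsubmx z) /\ Y (rsubmx z)];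
  ominimal_proj n (X : set 'rV[R]_(n + 1)) :
    D (n + 1)%N X -> D n [set lsubmx z | z in X];
  ominimal_algebraic n (X : set 'rV[R]_n) : algebraic_set X -> D n X;
  ominimal_tame (X : set 'rV[R]_1) : D 1%N X ->
    exists (s : seq R) (I : seq (interval R)),
      X = [set x | x ord0 ord0 \in s \/
                   exists2 i, i \in I & x ord0 ord0 \in i] }.

Definition definable_map (D : forall n, set (set 'rV[R]_n)) m n
    (A : set 'rV[R]_m) (f : 'rV[R]_m -> 'rV[R]_n) :=
  D (m + n)%N [set row_mx x (f x) | x in A].

End OMinimal.

Section Regular.
Variables (R : realType) (n : nat).
Implicit Types (x v : 'rV[R]_n) (A : 'M[R]_n) (S : set 'M[R]_n).

(* The library norm on 'rV[R]_n is the sup norm; it defines the same topology. *)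
Definition enorm v : R := Num.sqrt (\sum_(i < n) v ord0 i ^+ 2).

Definition eball x (r : R) : set 'rV[R]_n := [set y | enorm (y - x) < r].

(* Linear maps are represented by matrices acting on row vectors from the
   right, as in jacobian: A stands for v |-> v *m A. *)
Definition sigma A : \bar R :=
  ereal_inf [set (enorm (v *m A))%:E | v in [set v | enorm v = 1]].

Definition convex_hull S : set 'M[R]_n :=
  smallest (@convex_set R 'M[R]_n) S.

Variables (Omega : set 'rV[R]_n) (f : 'rV[R]_n -> 'rV[R]_n).

Definition Bset : set 'rV[R]_n :=
  [set x | Omega x /\
    ~ \forall y \near x, differentiable f y /\ {for y, continuous (jacobian f)}].

Definition dset (U : set 'rV[R]_n) : set 'M[R]_n :=
  [set jacobian f x | x in U `&` (Omega `\` Bset)].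

Definition nu x : \bar R :=
  lim ((fun r : R => ereal_inf (sigma @` convex_hull (dset (eball x r))))
         @ 0^'+).

Definition regular_point x := Omega x /\ (0 < nu x)%E.

Definition Sign x : R :=
  lim ((fun y => Num.sg (\det (jacobian f y)))
         @ within (Omega `\` Bset) (nbhs x)).

End Regular.

(* Main.v *)
(* If nu_f(xbar) > 0, then some convex hull of derivatives near xbar consists of
   matrices with nonzero determinant, so by the intermediate value theorem along
   segments the sign of det df is constant on a ball, off B_f.  It remains to see
   that B_f has empty interior, for otherwise Sign would be a limit along an
   improper filter at some points.

   Since the structure lives on the reals, Baire's theorem replaces cell
   decomposition.  By induction on n, every nonempty open set contains one on
   which a given definable set is either full or empty: on a vertical line this is
   tameness, and countably many pairs of rational endpoints suffice for all the
   lines.  Hence, if a nonempty open set is covered by countably many definable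
   sets, one of them has interior in it.

   For a continuous definable function g and a direction e, tameness gives a right
   derivative along e in [-oo, +oo] at each point.  It cannot be infinite on a box,
   since g grows along e by more than any multiple of the length.  So the box
   is covered by countably many definable sets on which
   |g(x + t e) - g(x) - c t| <= eps t for 0 < t < d, with c and d fixed, and
   one of them has interior.  Thus g has strict partial derivatives in a smaller
   box, and a map with strict partial derivatives in an open set is C^1 there. *)
Require Import Defs.
From HB Require Import structures.
From mathcomp Require mpoly.
From mathcomp Require Import all_boot all_order all_algebra.
From mathcomp Require Import all_classical all_reals all_analysis.
From mathcomp Require Import lra ring zify.
Set Implicit Arguments.
Unset Strict Implicit.
Unset Printing Implicit Defensive.
Import Order.TTheory GRing.Theory Num.Theory.
Import numFieldNormedType.Exports.
Import (canonicals) mpoly.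
Local Open Scope classical_set_scope.
Local Open Scope ring_scope.

(** * Definable sets and formulas *)

Section Environments.
Variable R : realType.

(** Points of all dimensions are read off infinite valuations, so that formulas in different
    dimensions combine without casts. *)
Definition trunc n (e : nat -> R) : 'rV[R]_n := \row_i e i.

Definition env n (x : 'rV[R]_n) (k : nat) : R :=
  if insub k is Some i then x ord0 i else 0.

Lemma truncE n e (i : 'I_n) : trunc n e ord0 i = e i.
Proof. by rewrite mxE. Qed.

Lemma env_ord n (x : 'rV[R]_n) (i : 'I_n) : env x i = x ord0 i.
Proof. by rewrite /env valK. Qed.

Lemma trunc_env n (x : 'rV[R]_n) : trunc n (env x) = x.
Proof. by apply/rowP => i; rewrite mxE env_ord. Qed.

Lemma eq_trunc n e e' :
  (forall k, (k < n)%N -> e k = e' k) -> trunc n e = trunc n e'.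
Proof. by move=> H; apply/rowP => i; rewrite !mxE H. Qed.

Lemma trunc_inj n e e' k : (k < n)%N -> trunc n e = trunc n e' -> e k = e' k.
Proof. by move=> kn /rowP/(_ (Ordinal kn)); rewrite !mxE. Qed.

Lemma lsubmx_trunc m n e : lsubmx (trunc (m + n) e) = trunc m e.
Proof. by apply/rowP => i; rewrite !mxE. Qed.

Lemma rsubmx_trunc m n e :
  rsubmx (trunc (m + n) e) = trunc n (fun k => e (m + k)%N).
Proof. by apply/rowP => i; rewrite !mxE. Qed.

End Environments.

Section Definability.
Variables (R : realType) (D : forall n : nat, set (set 'rV[R]_n)).
Arguments D : clear implicits.
Hypothesis hD : ominimal D.
Implicit Types (e : nat -> R) (P Q : (nat -> R) -> Prop) (t u : (nat -> R) -> R).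

Lemma D_setT n : D n setT.
Proof. by rewrite -setC0; apply: ominimal_setC => //; apply: ominimal_set0. Qed.

Lemma D_setI n A B : D n A -> D n B -> D n (A `&` B).
Proof.
move=> DA DB; rewrite -(setCK (A `&` B)) setCI.
by apply: (ominimal_setC hD); apply: (ominimal_setU hD);
   apply: (ominimal_setC hD).
Qed.

Lemma D_weaken m n A : D m A -> D (m + n)%N [set z | A (lsubmx z)].
Proof.
move=> DA; rewrite (_ : [set _ | _] = [set z | A (lsubmx z) /\ setT (rsubmx z)]).
  by apply: (ominimal_prod hD) => //; exact: D_setT.
by apply/seteqP; split=> z //= [].
Qed.

Lemma D_rsubmx m n B : D n B -> D (m + n)%N [set z | B (rsubmx z)].
Proof.
move=> DB; rewrite (_ : [set _ | _] = [set z | setT (lsubmx z) /\ B (rsubmx z)]).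
  by apply: (ominimal_prod hD) => //; exact: D_setT.
by apply/seteqP; split=> z //= [].
Qed.

(** The structure projects out one coordinate at a time, hence the induction on [k]; the dropped
    coordinates are quantified inside the valuation [e]. *)
Lemma D_proj m k (A : set 'rV[R]_k) : (m <= k)%N -> D k A ->
  D m [set x | exists e, x = trunc m e /\ A (trunc k e)].
Proof.
elim: k A => [|k IHk] A.
  rewrite leqn0 => /eqP -> DA; rewrite (_ : [set _ | _] = A) //.
  apply/seteqP; split=> x /= => [[e [-> //]]|Ax].
  by exists (env x); rewrite trunc_env.
rewrite leq_eqVlt => /orP[/eqP ->|mk] DA.
  rewrite (_ : [set _ | _] = A) //.
  apply/seteqP; split=> x /= => [[e [-> //]]|Ax].
  by exists (env x); rewrite trunc_env.
pose A' := [set y | exists e, y = trunc k e /\ A (trunc k.+1 e)].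
have DA' : D k A'.
  rewrite /A'; move: A {A'} DA; rewrite -(addn1 k) => A DA.
  rewrite (_ : [set _ | _] = [set lsubmx z | z in A]);
    first exact: (ominimal_proj hD).
  apply/seteqP; split=> y /= [z].
    by move=> [-> Az]; exists (trunc (k + 1) z); [|exact: lsubmx_trunc].
  move=> Az <-; exists (env z).
  by rewrite trunc_env; split=> //; rewrite -(lsubmx_trunc k 1) trunc_env.
have := IHk _ mk DA'.
rewrite (_ : [set _ | _] = [set x | exists e, x = trunc m e /\ A (trunc k.+1 e)]) //.
apply/seteqP; split=> x /= [e [-> ]].
  move=> [e' [ee' Ae']]; exists e'; split=> //; apply: eq_trunc => i im.
  by apply: trunc_inj ee'; apply: leq_trans im _.
by move=> Ae; exists e; split=> //; exists e.
Qed.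

Lemma D_polynomial n (p : mpoly.mpoly n R) :
  D n [set x | mpoly.meval (x ord0) p = 0].
Proof.
apply: (ominimal_algebraic hD); exists [set p].
by apply/seteqP; split=> x /= => [px q ->|]; last apply.
Qed.

Lemma D_forall n (I : finType) (A : I -> set 'rV[R]_n) :
  (forall i, D n (A i)) -> D n [set x | forall i, A i x].
Proof.
move=> DA; suff H (s : seq I) : D n [set x | forall i, i \in s -> A i x].
  have := H (enum I); congr (D n _); apply/seteqP; split=> x /= Ax i //.
  by apply: Ax; rewrite mem_enum.
elim: s => [|i s IHs].
  by rewrite (_ : [set _ | _] = setT); [exact: D_setT|apply/seteqP; split].
rewrite (_ : [set _ | _] = A i `&` [set x | forall i, i \in s -> A i x]).
  exact: D_setI.
apply/seteqP; split=> x /=.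
  move=> Ax; split; first by apply: Ax; rewrite mem_head.
  by move=> j js; apply: Ax; rewrite in_cons js orbT.
by move=> [Aix Ax] j; rewrite in_cons => /orP[/eqP ->|/Ax].
Qed.

(** Substitution as a projection: next to the [m] new coordinates sit [n] copies, tied to them by
    the linear equations of [E]; [A] is imposed on the copies, which are then projected away. *)
Lemma D_rename n m (A : set 'rV[R]_n) (s : nat -> nat) :
  D n A -> (forall k, (k < n)%N -> (s k < m)%N) ->
  exists C, D m C /\ forall e, C (trunc m e) <-> A (trunc n (fun k => e (s k))).
Proof.
move=> DA sm.
pose E := [set z : 'rV[R]_(m + n) | forall k : 'I_n,
  mpoly.meval (z ord0)
    (mpoly.mpolyX R (mpoly.mnm1 (rshift m k)) -
     mpoly.mpolyX R (mpoly.mnm1 (lshift n (Ordinal (sm k (ltn_ord k)))))) = 0].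
have DE : D (m + n)%N E by apply: D_forall => k; exact: D_polynomial.
exists [set x | exists e, x = trunc m e /\
  ([set z | A (rsubmx z)] `&` E) (trunc (m + n) e)]; split.
  by apply: D_proj; [exact: leq_addr|apply: D_setI => //; exact: D_rsubmx].
have EP e : E (trunc (m + n) e) <-> forall k, (k < n)%N -> e (m + k)%N = e (s k).
  split=> [Ee k kn|H k].
    have := Ee (Ordinal kn); rewrite mpoly.mevalB !mpoly.mevalXU !mxE /=.
    by move/eqP; rewrite subr_eq0 => /eqP.
  by rewrite mpoly.mevalB !mpoly.mevalXU !mxE /= H ?subrr.
move=> e; split=> /=.
  move=> [e' [ee']]; rewrite rsubmx_trunc => -[+ /EP Ee'].
  suff -> : trunc n (fun k => e' (m + k)%N) = trunc n (fun k => e (s k)) by [].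
  by apply: eq_trunc => k kn; rewrite Ee' //; apply/esym/(trunc_inj (sm _ kn) ee').
move=> Ae; exists (fun k => if (k < m)%N then e k else e (s (k - m)%N)).
split; first by apply: eq_trunc => k ->.
rewrite rsubmx_trunc; split.
  move: Ae; congr A; apply: eq_trunc => k kn.
  by rewrite ltnNge leq_addr addKn.
by apply/EP => k kn; rewrite ltnNge leq_addr addKn sm.
Qed.

(* Formulas are handled semantically: the variables are natural numbers
   (de Bruijn indices), and a formula is a predicate on their valuations. *)
Definition dpred P := exists n (A : set 'rV[R]_n),
  D n A /\ forall e, P e <-> A (trunc n e).

(** Brings several formulas to a common dimension before they are combined. *)
Lemma dpred_large P : dpred P -> exists n0, forall n, (n0 <= n)%N ->
  exists A : set 'rV[R]_n, D n A /\ forall e, P e <-> A (trunc n e).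
Proof.
move=> [n0 [A [DA PA]]]; exists n0 => n /subnKC <-.
exists [set z | A (lsubmx z)]; split; first exact: D_weaken.
by move=> e /=; rewrite lsubmx_trunc.
Qed.

(** The representing set may live in any dimension: it is enlarged to one that is at least [n], and
    the surplus variables are projected out. *)
Lemma dpred_set n (P : 'rV[R]_n -> Prop) :
  dpred (fun e => P (trunc n e)) -> D n [set x | P x].
Proof.
move=> /dpred_large[n0 /(_ (maxn n0 n) (leq_maxl _ _))[A [DA PA]]].
have := D_proj (leq_maxr n0 n) DA; congr (D n _).
apply/seteqP; split=> x /= => [[e [-> /PA //]]|Px].
by exists (env x); rewrite trunc_env; split=> //; apply/PA; rewrite trunc_env.
Qed.

Lemma dpred_iff P Q : (forall e, P e <-> Q e) -> dpred P -> dpred Q.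
Proof.
by move=> PQ [n [A [DA PA]]]; exists n, A; split=> // e; rewrite -PQ.
Qed.

Lemma dpred_not P : dpred P -> dpred (fun e => ~ P e).
Proof.
move=> [n [A [DA PA]]]; exists n, (~` A); split; first exact: (ominimal_setC hD).
by move=> e; rewrite PA.
Qed.

Lemma dpred_and P Q : dpred P -> dpred Q -> dpred (fun e => P e /\ Q e).
Proof.
move=> /dpred_large[n /(_ (maxn n _) (leq_maxl _ _)) HA].
move=> /dpred_large[m /(_ (maxn n m) (leq_maxr _ _))[B [DB QB]]].
have [A [DA PA]] := HA m.
exists (maxn n m), (A `&` B); split; first exact: D_setI.
by move=> e; rewrite PA QB.
Qed.

Lemma dpred_or P Q : dpred P -> dpred Q -> dpred (fun e => P e \/ Q e).
Proof.
move=> dP dQ; apply: (@dpred_iff (fun e => ~ (~ P e /\ ~ Q e))).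
  by move=> e; rewrite not_andE !notK.
by apply/dpred_not/dpred_and; exact: dpred_not.
Qed.

Lemma dpred_imply P Q : dpred P -> dpred Q -> dpred (fun e => P e -> Q e).
Proof.
move=> dP dQ; apply: (@dpred_iff (fun e => ~ P e \/ Q e)).
  by move=> e; split=> [[]//|PQ]; have [/PQ|] := pselect (P e); [right|left].
by apply: dpred_or => //; exact: dpred_not.
Qed.

Lemma dpred_allfin (I : finType) (P : I -> (nat -> R) -> Prop) :
  (forall i, dpred (P i)) -> dpred (fun e => forall i, P i e).
Proof.
move=> dP; have /choice[N HN] := fun i => dpred_large (dP i).
pose n := (\max_i N i)%N.
have /choice[A HA] := fun i => HN i n (leq_bigmax i).
exists n, [set x | forall i, A i x]; split.
  by apply: D_forall => i; have [] := HA i.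
by move=> e; split=> H i; have [_ /(_ e) Pi] := HA i; apply/Pi/H.
Qed.

Lemma dpred_rename P (s : nat -> nat) :
  dpred P -> dpred (fun e => P (fun k => e (s k))).
Proof.
move=> [n [A [DA PA]]].
have [|C [DC CP]] := D_rename (m := (\max_(k < n) s k).+1) (s := s) DA.
  by move=> k kn; rewrite ltnS (leq_bigmax (Ordinal kn)).
by exists (\max_(k < n) s k).+1, C; split=> // e; rewrite CP PA.
Qed.

Lemma dpred_exv n (P : 'rV[R]_n -> (nat -> R) -> Prop) :
  dpred (fun e => P (trunc n e) (fun k => e (n + k)%N)) ->
  dpred (fun e => exists x, P x e).
Proof.
move=> /dpred_large[m /(_ (n + m)%N (leq_addl _ _))[A [DA PA]]].
(* The bound vector comes first in the de Bruijn order, but projections drop the last coordinates;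
   [s] moves its block behind the [m] free variables. *)
pose s k := if (k < n)%N then (m + k)%N else (k - n)%N.
have [|C [DC CP]] := D_rename (m := (m + n)%N) (s := s) DA.
  by move=> k kmn; rewrite /s; case: ifP; lia.
exists m, [set x | exists e, x = trunc m e /\ C (trunc (m + n) e)].
split; first by apply: D_proj => //; exact: leq_addr.
have AP x e : A (trunc (n + m) (fun k => if (k < n)%N then env x k else e (k - n)%N))
    <-> P x e.
  rewrite -PA; suff -> : trunc n (fun k =>
    if (k < n)%N then env x k else e (k - n)%N) = x.
    suff -> : (fun k => if (n + k < n)%N then env x (n + k)
                        else e (n + k - n)%N) = e by [].
    by apply/funext => k; rewrite ltnNge leq_addr addKn.
  by rewrite -[RHS]trunc_env; apply: eq_trunc => k ->.
move=> e; split=> /= [[x Px]|[e' [ee' /CP Ae']]].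
  exists (fun k => if (k < m)%N then e k else env x (k - m)).
  split; first by apply: eq_trunc => k ->.
  apply/CP; move/AP: Px; congr A; apply: eq_trunc => k knm.
  rewrite /s; case: ifPn => kn; first by rewrite ltnNge leq_addr addKn.
  by case: ifPn => //; lia.
exists (trunc n (fun k => e' (m + k)%N)); apply/AP.
move: Ae'; congr A; apply: eq_trunc => k knm.
rewrite /s; case: ifPn => kn.
  by rewrite -[k]/(nat_of_ord (Ordinal kn)) env_ord mxE.
by apply/esym/(trunc_inj _ ee'); lia.
Qed.

Lemma dpred_allv n (P : 'rV[R]_n -> (nat -> R) -> Prop) :
  dpred (fun e => P (trunc n e) (fun k => e (n + k)%N)) ->
  dpred (fun e => forall x, P x e).
Proof.
move=> dP; apply: (@dpred_iff (fun e => ~ exists x, ~ P x e)).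
  move=> e; split=> [H x|H [x]]; last by apply; exact: H.
  by apply: contrapT => NP; apply: H; exists x.
by apply/dpred_not/dpred_exv/dpred_not.
Qed.

Lemma dpred_ex (P : R -> (nat -> R) -> Prop) :
  dpred (fun e => P (e 0%N) (fun k => e k.+1)) -> dpred (fun e => exists a, P a e).
Proof.
move=> dP; apply: (@dpred_iff (fun e => exists x : 'rV[R]_1, P (x ord0 ord0) e)).
  move=> e; split=> [[x Px]|[a Pa]]; first by exists (x ord0 ord0).
  by exists (const_mx a); rewrite mxE.
by apply: dpred_exv; apply: dpred_iff dP => e; rewrite mxE.
Qed.

Lemma dpred_all (P : R -> (nat -> R) -> Prop) :
  dpred (fun e => P (e 0%N) (fun k => e k.+1)) -> dpred (fun e => forall a, P a e).
Proof.
move=> dP; apply: (@dpred_iff (fun e => ~ exists a, ~ P a e)).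
  move=> e; split=> [H x|H [x]]; last by apply; exact: H.
  by apply: contrapT => NP; apply: H; exists x.
by apply/dpred_not/dpred_ex/dpred_not.
Qed.

(** Definability of the graph, with the value as the newest de Bruijn variable. *)
Definition dterm t := dpred (fun e => e 0%N = t (fun k => e k.+1)).

Lemma dterm_graph t i (s : nat -> nat) :
  dterm t -> dpred (fun e => e i = t (fun k => e (s k))).
Proof. by move=> /(@dpred_rename _ (fun k => if k is j.+1 then s j else i)). Qed.

Lemma dterm_rename t (s : nat -> nat) :
  dterm t -> dterm (fun e => t (fun k => e (s k))).
Proof. by move=> dt; apply: (dterm_graph 0 (fun k => (s k).+1) dt). Qed.

Lemma dpred_polynomial n (p : mpoly.mpoly n R) :
  dpred (fun e => mpoly.meval (trunc n e ord0) p = 0).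
Proof.
by exists n, [set x | mpoly.meval (x ord0) p = 0]; split=> //; exact: D_polynomial.
Qed.

Lemma dterm_cst a : dterm (fun=> a).
Proof.
rewrite /dterm; refine (dpred_iff _ (@dpred_polynomial 1
  (mpoly.mpolyX R (mpoly.mnm1 ord0) - mpoly.mpolyC 1 a))) => e.
rewrite mpoly.mevalB mpoly.mevalXU mpoly.mevalC truncE /=.
by split=> [/eqP|->]; rewrite ?subrr // subr_eq0 => /eqP.
Qed.

Lemma dterm_var i : dterm (fun e => e i).
Proof.
suff H : dpred (fun e => e 0%N = e 1%N).
  by have := @dpred_rename _ (fun k => if k is 1 then i.+1 else 0)%N H.
have i1 : (1 < 2)%N by [].
refine (dpred_iff _ (@dpred_polynomial 2 (mpoly.mpolyX R (mpoly.mnm1 ord0)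
   - mpoly.mpolyX R (mpoly.mnm1 (Ordinal i1))))) => e.
rewrite mpoly.mevalB !mpoly.mevalXU !truncE /=.
by split=> [/eqP|->]; rewrite ?subrr // subr_eq0 => /eqP.
Qed.

Lemma dterm_add0 : dpred (fun e => e 0%N = e 1%N + e 2%N).
Proof.
have i1 : (1 < 3)%N by []. have i2 : (2 < 3)%N by [].
refine (dpred_iff _ (@dpred_polynomial 3 (mpoly.mpolyX R (mpoly.mnm1 ord0)
   - (mpoly.mpolyX R (mpoly.mnm1 (Ordinal i1)) +
      mpoly.mpolyX R (mpoly.mnm1 (Ordinal i2)))))) => e.
rewrite mpoly.mevalB mpoly.mevalD !mpoly.mevalXU !truncE /=.
by split=> [/eqP|->]; rewrite ?subrr // subr_eq0 => /eqP.
Qed.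

Lemma dterm_mul0 : dpred (fun e => e 0%N = e 1%N * e 2%N).
Proof.
have i1 : (1 < 3)%N by []. have i2 : (2 < 3)%N by [].
refine (dpred_iff _ (@dpred_polynomial 3 (mpoly.mpolyX R (mpoly.mnm1 ord0)
   - (mpoly.mpolyX R (mpoly.mnm1 (Ordinal i1)) *
      mpoly.mpolyX R (mpoly.mnm1 (Ordinal i2)))))) => e.
rewrite mpoly.mevalB mpoly.mevalM !mpoly.mevalXU !truncE /=.
by split=> [/eqP|->]; rewrite ?subrr // subr_eq0 => /eqP.
Qed.

Lemma dterm_comp2 (op : R -> R -> R) t u :
  dpred (fun e => e 0%N = op (e 1%N) (e 2%N)) ->
  dterm t -> dterm u -> dterm (fun e => op (t e) (u e)).
Proof.
move=> dop dt du; apply: (@dpred_iff (fun e => exists a b,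
   [/\ a = t (fun k => e k.+1), b = u (fun k => e k.+1) & e 0%N = op a b])).
  move=> e; split=> [[a [b [-> -> //]]]|->].
  by exists (t (fun k => e k.+1)), (u (fun k => e k.+1)).
apply: dpred_ex; apply: dpred_ex => /=.
(* Under the two quantifiers, variable 0 is [b], variable 1 is [a], variable 2 is the value, and the
   arguments start at 3. *)
apply: (@dpred_iff (fun e => e 1%N = t (fun k => e k.+3) /\
    (e 0%N = u (fun k => e k.+3) /\ e 2%N = op (e 1%N) (e 0%N)))).
  by move=> e; split=> [[? []]|[]].
apply: dpred_and; first exact: dterm_graph.
apply: dpred_and; first exact: dterm_graph.
exact: (@dpred_rename _ (fun k => match k with 0 => 2 | 1 => 1 | _ => 0 end)%N dop).
Qed.

Lemma dterm_add t u : dterm t -> dterm u -> dterm (fun e => t e + u e).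
Proof. exact: (dterm_comp2 dterm_add0). Qed.

Lemma dterm_mul t u : dterm t -> dterm u -> dterm (fun e => t e * u e).
Proof. exact: (dterm_comp2 dterm_mul0). Qed.

Lemma dterm_opp t : dterm t -> dterm (fun e => - t e).
Proof.
move=> dt; have := dterm_mul (dterm_cst (-1)) dt.
by congr dterm; apply/funext => e; rewrite mulN1r.
Qed.

Lemma dpred_eq t u : dterm t -> dterm u -> dpred (fun e => t e = u e).
Proof.
move=> dt du; apply: (@dpred_iff (fun e => exists a, a = t e /\ a = u e)).
  by move=> e; split=> [[a [-> //]]|tu]; exists (u e).
by apply: dpred_ex; apply: dpred_and; exact: dterm_graph.
Qed.

(** The order is definable from the field operations, since the nonnegative reals are the
    squares. *)
Lemma dpred_le t u : dterm t -> dterm u -> dpred (fun e => t e <= u e).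
Proof.
move=> dt du; apply: (@dpred_iff (fun e => exists a, u e = t e + a * a)).
  move=> e; split=> [[a ->]|tu]; first by rewrite lerDl -expr2 sqr_ge0.
  by exists (Num.sqrt (u e - t e)); rewrite -expr2 sqr_sqrtr ?subr_ge0 // subrKC.
apply: dpred_ex; apply: dpred_eq; first exact: dterm_rename.
apply: dterm_add; first exact: dterm_rename.
by apply: dterm_mul; exact: dterm_var.
Qed.

Lemma dpred_lt t u : dterm t -> dterm u -> dpred (fun e => t e < u e).
Proof.
move=> dt du; apply: (@dpred_iff (fun e => ~ u e <= t e)).
  by move=> e; rewrite ltNge; split=> /negP.
by apply/dpred_not/dpred_le.
Qed.

Definition dvec n (v : (nat -> R) -> 'rV[R]_n) :=
  forall i, dterm (fun e => v e ord0 i).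

Lemma dvec_trunc n (s : nat -> nat) : dvec (fun e => trunc n (fun k => e (s k))).
Proof.
move=> i; have := dterm_var (s i).
by congr dterm; apply/funext => e; rewrite truncE.
Qed.

Lemma dvec_cst n (x : 'rV[R]_n) : dvec (fun=> x).
Proof. by move=> i; exact: dterm_cst. Qed.

Lemma dvec_add n (v w : (nat -> R) -> 'rV[R]_n) :
  dvec v -> dvec w -> dvec (fun e => v e + w e).
Proof.
move=> dv dw i; have := dterm_add (dv i) (dw i).
by congr dterm; apply/funext => e; rewrite mxE.
Qed.

Lemma dvec_scale n t (v : (nat -> R) -> 'rV[R]_n) :
  dterm t -> dvec v -> dvec (fun e => t e *: v e).
Proof.
move=> dt dv i; have := dterm_mul dt (dv i).
by congr dterm; apply/funext => e; rewrite mxE.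
Qed.

Lemma dvec_row m n (v : (nat -> R) -> 'rV[R]_m) (w : (nat -> R) -> 'rV[R]_n) :
  dvec v -> dvec w -> dvec (fun e => row_mx (v e) (w e)).
Proof.
move=> dv dw i; case: (split_ordP i) => j ->.
  by have := dv j; congr dterm; apply/funext => e; rewrite row_mxEl.
by have := dw j; congr dterm; apply/funext => e; rewrite row_mxEr.
Qed.

Lemma dvec_const_mx n t : dterm t -> dvec (fun e => const_mx (t e) : 'rV[R]_n).
Proof. by move=> dt i; move: dt; congr dterm; apply/funext => e; rewrite mxE. Qed.

Lemma dpred_mem n (A : set 'rV[R]_n) (v : (nat -> R) -> 'rV[R]_n) :
  D n A -> dvec v -> dpred (fun e => A (v e)).
Proof.
move=> DA dv.
apply: (@dpred_iff (fun e => exists x, A x /\ forall i, x ord0 i = v e ord0 i)).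
  move=> e; split=> [[x [Ax xv]]|Av]; last by exists (v e).
  by rewrite (_ : v e = x) //; apply/rowP => i; rewrite xv.
apply: dpred_exv; apply: dpred_and; first by exists n, A.
apply: dpred_allfin => i; apply: dpred_eq; first by apply: (@dvec_trunc _ id).
exact: (dterm_rename _ (dv i)).
Qed.

Definition dfun n (g : 'rV[R]_n -> R) := dterm (fun e => g (trunc n e)).

Lemma dterm_fun n (g : 'rV[R]_n -> R) (v : (nat -> R) -> 'rV[R]_n) :
  dfun g -> dvec v -> dterm (fun e => g (v e)).
Proof.
move=> dg dv; apply: (@dpred_iff (fun e => exists x : 'rV[R]_n,
   (forall i, x ord0 i = v (fun k => e k.+1) ord0 i) /\ e 0%N = g x)).
  move=> e; split=> [[x [xv ->]]|->]; last by exists (v (fun k => e k.+1)).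
  by congr g; apply/rowP => i; rewrite xv.
apply: dpred_exv; apply: dpred_and.
  apply: dpred_allfin => i; apply: dpred_eq; first by apply: (@dvec_trunc _ id).
  exact: (dterm_rename _ (dv i)).
exact: (dterm_graph _ id dg).
Qed.

End Definability.

(** * Generic behaviour of definable sets *)

(* The library has all the ingredients of this instance but not the join. *)
HB.instance Definition _ (R : realType) m n := NormedModule.on 'M[R]_(m, n).

(** * Right germs of tame subsets of the line *)

Section TameLine.
Variable R : realType.
Implicit Types (B C : set R) (a : R).

(** The form in which tameness is used: the germ of [B] at the right of [a] is full or empty. *)
Definition right_germ a B := exists2 d, 0 < d &
  (forall t, a < t < a + d -> B t) \/ (forall t, a < t < a + d -> ~ B t).

Lemma right_germ_setU a B C :
  right_germ a B -> right_germ a C -> right_germ a (B `|` C).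
Proof.
move=> [d d0 HB] [d' d'0 HC]; exists (Num.min d d'); first by rewrite lt_min d0.
have lt1 t : a < t < a + Num.min d d' -> a < t < a + d.
  by move=> /andP[-> /=] /lt_le_trans; apply; rewrite lerD2l ge_min lexx.
have lt2 t : a < t < a + Num.min d d' -> a < t < a + d'.
  by move=> /andP[-> /=] /lt_le_trans; apply; rewrite lerD2l ge_min lexx orbT.
case: HB => HB; first by left=> t /lt1/HB; left.
case: HC => HC; first by left=> t /lt2/HC; right.
by right=> t Ht [/(HB t (lt1 t Ht))|/(HC t (lt2 t Ht))].
Qed.

Lemma right_germ_set1 a p : right_germ a [set p].
Proof.
have [ap|pa] := ltP a p.
  exists (p - a); first by rewrite subr_gt0.
  by right=> t /andP[_]; rewrite subrKC => + tp; rewrite tp ltxx.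
exists 1 => //; right=> t /andP[+ _] tp; rewrite tp => /lt_le_trans/(_ pa).
by rewrite ltxx.
Qed.

(** If [B] accumulates at [a] from the right, convexity puts into [B] everything between [a] and a
    point [q] of [B] beyond it. *)
Lemma right_germ_interval a B : is_interval B -> right_germ a B.
Proof.
move=> iB; have [[d d0 HB]|HB] := pselect (exists2 d, 0 < d &
    forall t, a < t < a + d -> ~ B t); first by exists d => //; right.
have near_a d : 0 < d -> exists2 t, a < t < a + d & B t.
  move=> d0; apply: contrapT => NB; apply: HB; exists d => // t at_ Bt.
  by apply: NB; exists t.
have [q /andP[aq _] Bq] := near_a 1 ltr01.
exists (q - a); rewrite ?subr_gt0 //; left=> t; rewrite subrKC => /andP[at_ tq].
have [|p] := near_a (t - a); first by rewrite subr_gt0.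
by rewrite subrKC => /andP[_ pt] Bp; apply: (iB p q) => //; rewrite !ltW.
Qed.

Lemma right_germ_tame a (s : seq R) (I : seq (interval R)) :
  right_germ a [set t | t \in s \/ exists2 i, i \in I & t \in i].
Proof.
have g0 : right_germ a set0 by exists 1 => //; right=> t _ [].
change (right_germ a ([set t | t \in s] `|` [set t | exists2 i, i \in I & t \in i])).
apply: right_germ_setU.
  elim: s => [|p s IHs]; first by rewrite (_ : [set _ | _] = set0) // -subset0.
  rewrite (_ : [set _ | _] = [set p] `|` [set t | t \in s]).
    by apply: right_germ_setU => //; exact: right_germ_set1.
  apply/seteqP; split=> t /=; rewrite in_cons; last first.
    by move=> [->|->]; rewrite ?eqxx ?orbT.
  by move=> /orP[/eqP|]; [left|right].
elim: I => [|i I IHI].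
  by rewrite (_ : [set _ | _] = set0) // -subset0 => t /= [].
rewrite (_ : [set _ | _] = [set` i] `|` [set t | exists2 i, i \in I & t \in i]).
  apply: right_germ_setU => //; apply: right_germ_interval.
  exact: interval_is_interval.
apply/seteqP; split=> t /=.
  by move=> [j]; rewrite in_cons => /orP[/eqP ->|jI] tj; [left|right; exists j].
move=> [ti|[j jI tj]]; first by exists i => //; rewrite mem_head.
by exists j => //; rewrite in_cons jI orbT.
Qed.

End TameLine.

(** * Baire category for definable sets *)

Section Generic.
Variables (R : realType) (D : forall n : nat, set (set 'rV[R]_n)).
Arguments D : clear implicits.
Hypothesis hD : ominimal D.

Definition fat (T : topologicalType) (O : set T) := open O /\ O !=set0.

Lemma fat_ball n (x : 'rV[R]_n) r : 0 < r -> fat (ball x r).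
Proof. by move=> r0; split; [exact: ball_open|exists x; exact: ballxx]. Qed.

Lemma fat_sub_ball n (O : set 'rV[R]_n) x : open O -> O x ->
  exists2 r, 0 < r & ball x r `<=` O.
Proof.
rewrite openE => /(_ x) /[apply]; rewrite /interior => /nbhs_ballP[r /= r0 rO].
by exists r.
Qed.

(** For [n = 0] the coordinate condition is vacuous, so the positivity of [r] is stated apart. *)
Lemma ball_rowP n (x y : 'rV[R]_n) r :
  ball x r y <-> 0 < r /\ forall i, `|x ord0 i - y ord0 i| < r.
Proof.
split=> [[r0 H]|[r0 H]]; split=> // i; first exact: H.
by move=> j; rewrite ord1; exact: H.
Qed.

Lemma tame_right_germ (B : set 'rV[R]_1) a : D 1%N B ->
  right_germ a [set t | B (const_mx t)].
Proof.
move=> /(ominimal_tame hD)[s [I ->]].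
have := right_germ_tame a s I; congr right_germ.
by apply/seteqP; split=> t /=; rewrite mxE.
Qed.

Definition dichotomy n := forall (A O : set 'rV[R]_n), D n A -> fat O ->
  exists U, [/\ fat U, U `<=` O & U `<=` A \/ U `<=` ~` A].

Definition countable_cover n := forall (J : countType) (A : J -> set 'rV[R]_n) O,
  (forall i, D n (A i)) -> fat O -> (forall x, O x -> exists i, A i x) ->
  exists i, exists U, [/\ fat U, U `<=` O & U `<=` A i].

(** If no [A i] filled an open part of [O], the dichotomy would make the interior of each complement
    dense in [O], and Baire's theorem would give a point of [O] outside all the [A i]. *)
Lemma dichotomy_cover n : dichotomy n -> countable_cover n.
Proof.
move=> dich J A O DA fO OA; apply: contrapT => NH.
(* Baire's theorem concerns the whole space, so the exterior of [O] is added to each set; numbers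
   that code no index get the whole space. *)
pose F k : set 'rV[R]_n :=
  (if unpickle k is Some i then (~` A i)° else setT) `|` (~` O)°.
suff H k : open (F k) /\ dense (F k).
  have [a [Oa Fa]] := Baire H fO.2 fO.1.
  have [i Aia] := OA a Oa; have [] := Fa (pickle i) I.
    by rewrite pickleK => /interior_subset.
  by move=> /interior_subset.
split.
  by apply: openU; [case: unpickle => [i|]; [exact: open_interior|exact: openT]
                   |exact: open_interior].
move=> W W0 oW; have [WO0|WO0] := pselect (W `&` O !=set0); last first.
  have [w Ww] := W0; exists w; split=> //; right.
  suff : W `<=` (~` O)° by apply.
  by rewrite -open_subsetE // => z Wz Oz; apply: WO0; exists z.
rewrite /F; case: unpickle => [i|]; last first.
  by have [w [Ww _]] := WO0; exists w; split=> //; left.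
have [] := dich (A i) (W `&` O) (DA i).
  by split=> //; apply: openI => //; exact: fO.1.
move=> U [[oU [z Uz] ] UWO [inA | inA] ].
  by case: NH; exists i, U; split=> // [|y /UWO[] //]; split=> //; exists z.
exists z; split; first by have [] := UWO _ Uz.
left; suff : U `<=` (~` A i)° by apply.
by rewrite -open_subsetE.
Qed.

(** On each vertical line, membership in [A] is decided on some rational interval above the height
    [t0]. There are countably many intervals and two outcomes, so one choice serves an open set of
    base points, and this gives a box. *)
Lemma dichotomyS n : countable_cover n -> dichotomy (n + 1).
Proof.
move=> cov A O DA [oO [z Oz]].
have [r r0 rO] := fat_sub_ball oO Oz.
pose x0 := lsubmx z; pose t0 := rsubmx z ord0 ord0.
pose pt (x : 'rV[R]_n) (t : R) : 'rV[R]_(n + 1) := row_mx x (const_mx t).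
have ptP x t e y s : 0 < e -> ball x e y -> `|t - s| < e -> ball (pt x t) e (pt y s).
  move=> e0 /ball_rowP[_ xy] ts; apply/ball_rowP; split=> // i.
  by case: (split_ordP i) => j ->; rewrite ?row_mxEl ?row_mxEr ?mxE.
have ptK w : w = pt (lsubmx w) (rsubmx w ord0 ord0).
  rewrite /pt -[LHS]hsubmxK; congr row_mx.
  by apply/rowP => i; rewrite ord1 [RHS]mxE.
(* The index is an interval with an outcome; the bounds by [t0 - r] and [t0 + r] keep the resulting
   box inside [O]. *)
pose S (k : rat * rat * bool) : set 'rV[R]_n :=
  [set x | [/\ ratr k.1.1 < ratr k.1.2 :> R, t0 - r < ratr k.1.1, ratr k.1.2 < t0 + r &
    forall t, ratr k.1.1 < t /\ t < ratr k.1.2 ->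
      if k.2 then A (pt x t) else ~ A (pt x t)]].
have dA : dpred D (fun e => A (pt (trunc n (fun k => e k.+1)) (e 0%N))).
  apply: (dpred_mem hD) => //; apply: dvec_row; first exact: dvec_trunc.
  by apply: dvec_const_mx; exact: dterm_var.
have DS k : D n (S k).
  apply: (dpred_set hD).
  apply: (@dpred_iff _ _ (fun e => ratr k.1.1 < ratr k.1.2 :> R /\
    (t0 - r < ratr k.1.1 /\ (ratr k.1.2 < t0 + r /\
    forall t, ratr k.1.1 < t /\ t < ratr k.1.2 ->
     if k.2 then A (pt (trunc n e) t) else ~ A (pt (trunc n e) t))))).
    by move=> e; split=> [[? [? []]]|[]].
  apply: (dpred_and hD); first by apply: (dpred_lt hD); exact: dterm_cst.
  apply: (dpred_and hD); first by apply: (dpred_lt hD); exact: dterm_cst.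
  apply: (dpred_and hD); first by apply: (dpred_lt hD); exact: dterm_cst.
  apply: (dpred_all hD); apply: (dpred_imply hD).
    by apply: (dpred_and hD); apply: (dpred_lt hD); [exact: dterm_cst|exact: dterm_var
       |exact: dterm_var|exact: dterm_cst].
  by case: k.2 => //; exact: dpred_not.
have [x xx0|[[p q] b] [U [ [oU [y Uy] ] UO US] ] ] :=
  cov _ S (ball x0 r) DS (fat_ball _ r0).
  have DB : D 1%N [set y | A (row_mx x y)].
    apply: (dpred_set hD); apply: (dpred_mem hD) => //.
    by apply: dvec_row; [exact: dvec_cst|exact: (dvec_trunc hD id)].
  have [d d0 HB] := tame_right_germ t0 DB.
  have hi : t0 < Num.min (t0 + d) (t0 + r) by rewrite lt_min !ltrDl d0.
  have [p] := rat_in_itvoo hi; rewrite in_itv /= => /andP[t0p phi].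
  have [q] := rat_in_itvoo phi; rewrite in_itv /= lt_min => /and3P[pq qd qr].
  case: HB => HB; [exists (p, q, true)|exists (p, q, false)].
    split=> //=; first by lra.
    by move=> t [pt_ tq]; apply: HB; apply/andP; split; lra.
  split=> //=; first by lra.
  by move=> t [pt_ tq]; apply: HB; apply/andP; split; lra.
have [pq tp qt _] := US _ Uy; rewrite /= in pq tp qt.
have [e e0 eU] := fat_sub_ball oU Uy.
(* Balls of the sup norm are boxes: this centre and this radius fit one into the product of [U] and
   the interval from [p] to [q]. *)
pose m : R := (ratr p + ratr q) / 2; pose e' := Num.min e ((ratr q - ratr p) / 2).
have e'0 : 0 < e' by rewrite lt_min e0 /=; lra.
have inU w : ball (pt y m) e' w ->
    U (lsubmx w) /\ ratr p < rsubmx w ord0 ord0 < ratr q.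
  move=> /ball_rowP[_ wm]; split.
    apply/eU/ball_rowP; split=> // i; have := wm (lshift 1 i).
    by rewrite row_mxEl mxE lt_min => /andP[].
  have := wm (rshift n ord0); rewrite row_mxEr mxE [rsubmx w _ _]mxE lt_min => /andP[_].
  by rewrite ltr_norml /m => /andP[? ?]; apply/andP; split; lra.
exists (ball (pt y m) e'); split; first exact: fat_ball.
  move=> w /inU[Uw /andP[pw wq]]; apply: rO; rewrite [z]ptK [w]ptK.
  apply: ptP => //; first exact: UO.
  by rewrite ltr_norml /t0 in tp qt *; apply/andP; split; lra.
case: b US => US; [left|right] => w /inU[Uw pwq].
  by rewrite [w]ptK; have [_ _ _] := US _ Uw; apply; apply/andP.
by rewrite /= [w]ptK; have [_ _ _] := US _ Uw; apply; apply/andP.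
Qed.

Lemma dichotomyP n : dichotomy n.
Proof.
elim: n => [|n IHn]; last by rewrite -addn1; exact/dichotomyS/dichotomy_cover.
move=> A U DA fU; have [x Ux] := fU.2.
have eqx y : y = x by apply/rowP => -[].
exists U; split=> //; have [Ax|NAx] := pselect (A x); [left|right] => y _.
  by rewrite (eqx y).
by rewrite (eqx y).
Qed.

Lemma countable_coverP n : countable_cover n.
Proof. exact/dichotomy_cover/dichotomyP. Qed.

End Generic.

(** * Strict one-sided slopes *)

Section Dini.
Variable R : realType.

(* A substitute for the mean value inequality which only needs the growth to the
   right of each point. *)
Lemma right_growth (h : R -> R) (a b M : R) : a <= b ->
  (forall t, a <= t <= b -> {for t, continuous h}) ->
  (forall t, a <= t < b -> exists s, [/\ t < s, s <= b & M * (s - t) <= h s - h t]) ->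
  M * (b - a) <= h b - h a.
Proof.
move=> ab ch growth; pose k x := h x - h a - M * (x - a).
pose S := [set x | a <= x <= b /\ 0 <= k x].
have Sa : S a by split; rewrite ?lexx //= /k !subrr mulr0 subrr.
have ubS : ubound S b by move=> x [/andP[]].
have supS : has_sup S by split; [exists a|exists b].
(* Continuity puts the supremum itself into [S]; if [s < b], the growth to the right of [s] produces
   a larger element. *)
set s := sup S.
have as_ : a <= s by apply: ub_le_sup => //; exists b.
have sb : s <= b by apply: ge_sup => //; exists a.
have ks : 0 <= k s.
  rewrite leNgt; apply/negP => ks0.
  have ck : k x @[x --> s] --> k s.
    apply: cvgB; first by apply: cvgB; [apply: ch; rewrite as_|exact: cvg_cst].
    by apply: cvgM; [exact: cvg_cst|apply: cvgB; [exact: cvg_id|exact: cvg_cst]].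
  have : nbhs s [set x | k x < 0] by exact: (cvgr_lt _ ck).
  move=> /nbhs_ballP[e /= e0 he].
  have [x Sx sx] := sup_adherent e0 supS.
  have xs : x <= s by apply: ub_le_sup => //; exists b.
  suff : k x < 0 by case: Sx => _ kx; rewrite ltNge kx.
  by apply: he; rewrite /ball /= ger0_norm ?subr_ge0 //; move: sx; rewrite -/s; lra.
have [s_lt_b|bs] := ltP s b; last first.
  have <- : s = b by apply/eqP; rewrite eq_le sb.
  by move: ks; rewrite /k; lra.
have [|t [st tb ht]] := growth s; first by rewrite as_.
have : S t.
  split; first by rewrite tb (le_trans as_) ?ltW.
  by move: ks; rewrite /k; lra.
by move=> /(ub_le_sup (ex_intro _ b ubS)); rewrite -/s leNgt st.
Qed.

End Dini.

(** * One-sided slopes of definable functions along an axis *)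

Section StrictPartial.
Variables (R : realType) (D : forall n : nat, set (set 'rV[R]_n)).
Arguments D : clear implicits.
Hypothesis hD : ominimal D.
Variables (n : nat) (g : 'rV[R]_n -> R) (i : 'I_n).
Hypothesis dg : dfun D g.

Definition incr (x : 'rV[R]_n) (t : R) := g (x + t *: delta_mx ord0 i) - g x.

(** The right derivative along axis [i] is +oo for [true] and -oo for [false]. Here and below,
    conjunctions and coordinatewise bounds replace intervals and balls, so that the closure lemmas
    for formulas apply as they stand. *)
Definition steep (b : bool) (x : 'rV[R]_n) := forall M, exists d, 0 < d /\
  forall t, 0 < t /\ t < d -> M * t <= (if b then 1 else -1) * incr x t.

Definition slope (eps c d : R) (x : 'rV[R]_n) := forall t, 0 < t /\ t < d ->
  incr x t - c * t <= eps * t /\ - (eps * t) <= incr x t - c * t.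

(** The same [c] and [d] serve all base points near [x]; this uniformity makes the resulting partial
    derivative strict. *)
Definition strict_slope (eps : R) (x : 'rV[R]_n) := exists d, 0 < d /\ exists c,
  forall y : 'rV[R]_n, (forall j, x ord0 j - y ord0 j < d /\ - d < x ord0 j - y ord0 j) ->
  slope eps c d y.

Lemma dterm_incr v t : dvec D v -> dterm D t -> dterm D (fun e => incr (v e) (t e)).
Proof.
move=> dv dt; apply: (dterm_add hD); last first.
  by apply: (dterm_opp hD); exact: (dterm_fun hD dg).
apply: (dterm_fun hD dg); apply: (dvec_add hD) => //.
by apply: (dvec_scale hD) => //; exact: dvec_cst.
Qed.

Ltac definable := repeat first
  [ exact: (dvec_trunc hD id) | exact: (dvec_trunc hD)
  | exact: (dterm_var hD) | exact: (dterm_cst hD)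
  | apply: (dpred_and hD) | apply: (dpred_imply hD) | apply: (dpred_all hD)
  | apply: (dpred_ex hD) | apply: (dpred_allv hD) | apply: (dpred_allfin hD) => ?
  | apply: (dpred_le hD) | apply: (dpred_lt hD)
  | apply: dterm_incr | apply: (dterm_add hD) | apply: (dterm_mul hD)
  | apply: (dterm_opp hD) ].

Lemma D_steep b : D n [set x | steep b x].
Proof. by apply: (dpred_set hD); rewrite /steep; definable. Qed.

Lemma D_slope eps c d : D n [set x | slope eps c d x].
Proof. by apply: (dpred_set hD); rewrite /slope; definable. Qed.

Lemma D_strict_slope eps : D n [set x | strict_slope eps x].
Proof. by apply: (dpred_set hD); rewrite /strict_slope /slope; definable. Qed.

Lemma D_strict : D n [set x | forall eps, 0 < eps -> strict_slope eps x].
Proof. by apply: (dpred_set hD); rewrite /strict_slope /slope; definable. Qed.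

(** By tameness, for each [M] the increment is eventually above or eventually below the line of
    slope [M]. If one side occurs for every [M], the point is steep; otherwise [sup P] is the finite
    right derivative. *)
Lemma steep_or_slope eps x : 0 < eps ->
  (exists b, steep b x) \/
  exists (c : rat) (k : nat), slope eps (ratr c) k.+1%:R^-1 x.
Proof.
move=> eps0; pose P M := exists2 d, 0 < d & forall t, 0 < t < d -> M * t <= incr x t.
pose N M := exists2 d, 0 < d & forall t, 0 < t < d -> incr x t < M * t.
have PN M : P M \/ N M.
  have DB : D 1%N [set y | incr x (y ord0 ord0) < M * y ord0 ord0].
    apply: (dpred_set hD); apply: (dpred_lt hD).
      by apply: dterm_incr; [exact: dvec_cst|exact: (dvec_trunc hD id)].
    by apply: (dterm_mul hD); [exact: dterm_cst|exact: (dvec_trunc hD id)].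
  have [d d0 H] := tame_right_germ hD 0 DB.
  case: H => H; [right|left]; exists d => // t; rewrite -{1}(add0r d) => /H /=;
    by rewrite !mxE // => /negP; rewrite -leNgt.
have [allP|/existsNP[M0 NP0]] := pselect (forall M, P M).
  left; exists true => M; have [d d0 Hd] := allP M; exists d; split=> // t [t0 td].
  by rewrite mul1r; apply: Hd; rewrite t0.
have [allN|/existsNP[M1 NN1]] := pselect (forall M, N M).
  left; exists false => M; have [d d0 Hd] := allN (- M); exists d; split=> // t [t0 td].
  by have := Hd t; rewrite t0 td => /(_ isT); rewrite !mulNr mul1r => ?; lra.
have P1 : P M1 by have [] := PN M1.
have N0 : N M0 by have [] := PN M0.
have NP M M' : N M -> P M' -> M' < M.
  move=> [d d0 Nd] [d' d'0 Pd]; rewrite ltNge; apply/negP => MM'.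
  pose t := Num.min d d' / 2.
  have t0 : 0 < t by rewrite divr_gt0 // lt_min d0.
  have tm : t < Num.min d d' by rewrite /t; move: t0; rewrite /t; lra.
  move: (tm); rewrite lt_min => /andP[td td'].
  have := Nd t; rewrite t0 td => /(_ isT).
  have := Pd t; rewrite t0 td' => /(_ isT) /le_lt_trans /[apply].
  by rewrite ltr_pM2r // ltNge MM'.
have supP : has_sup P by split; [exists M1|exists M0 => M /(NP _ _ N0)/ltW].
(* With [c] this close to the derivative, [c - eps] falls below it and [c + eps] above it. *)
have [c] : exists c : rat, ratr c \in `](sup P - eps), (sup P + eps)[.
  by apply: rat_in_itvoo; lra.
rewrite in_itv /= => /andP[c1 c2].
have [d1 d10 H1] : P (ratr c - eps).
  have c0 : 0 < sup P - (ratr c - eps) by lra.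
  have [M [d d0 HM] sM] := sup_adherent c0 supP.
  exists d => // t /[dup] /HM; move=> + /andP[t0 _]; apply: le_trans.
  by rewrite ler_pM2r //; lra.
have [d2 d20 H2] : N (ratr c + eps).
  have [P2|//] := PN (ratr c + eps).
  have : ratr c + eps <= sup P by apply: ub_le_sup => //; case: supP.
  lra.
pose d := Num.min d1 d2; have d0 : 0 < d by rewrite lt_min d10.
(* The Archimedean bound of [d^-1] makes [k.+1%:R^-1] at most [d]. *)
right; exists c, (Num.bound d^-1) => t [t0 tk].
have td : t < d.
  apply: lt_le_trans tk _; rewrite -[leRHS]invrK lef_pV2 ?posrE ?invr_gt0 //.
  by apply/ltW/(lt_trans (archi_boundP _)); rewrite ?invr_ge0 ?ltW // ltr_nat.
move: td; rewrite lt_min => /andP[td1 td2].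
have := H1 t; rewrite t0 td1 => /(_ isT).
by have := H2 t; rewrite t0 td2 => /(_ isT); rewrite mulrDl mulrBl => ? ?; lra.
Qed.

Lemma incrD x s t : incr (x + s *: delta_mx ord0 i) (t - s) = incr x t - incr x s.
Proof.
by rewrite /incr -addrA -scalerDl subrKC; ring.
Qed.

(** Along a segment of steep points of the same sign, [right_growth] applies with every [M], so the
    finite increment over the segment would exceed every bound. *)
Lemma steep_not_fat b U : fat U -> (forall x, U x -> {for x, continuous g}) ->
  ~ U `<=` steep b.
Proof.
move=> [oU [x Ux]] cg Usteep; have [r r0 rU] := fat_sub_ball oU Ux.
pose y t := x + t *: delta_mx ord0 i : 'rV[R]_n.
pose h t := (if b then 1 else -1) * incr x t.
have Uy t : 0 <= t <= r / 2 -> U (y t).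
  move=> /andP[t0 tr]; apply/rU/ball_rowP; split=> // j.
  rewrite !mxE opprD addNKr normrN normrM ger0_norm //.
  by case: (_ && _); rewrite ?normr1 ?normr0; lra.
have h0 : h 0 = 0 by rewrite /h /incr scale0r addr0 subrr mulr0.
have growth M : M * (r / 2) <= h (r / 2).
  have := @right_growth R h 0 (r / 2) M; rewrite h0 !subr0.
  apply; first lra.
    move=> t /Uy/cg gt; apply: cvgM; first exact: cvg_cst.
    apply: cvgB; last exact: cvg_cst.
    apply: (@continuous_comp _ _ _ y g) => //.
    apply: cvgD; first exact: cvg_cst.
    by apply: cvgZ; [exact: cvg_id|exact: cvg_cst].
  move=> t /andP[t0 tr]; have [|d [d0 Hd]] := Usteep (y t) _ M.
    by apply: Uy; rewrite t0 ltW.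
  (* Half of the minimum keeps [s] within the range [d] of steepness and before the end [r / 2]. *)
  pose s := t + Num.min d (r / 2 - t) / 2.
  have m0 : 0 < Num.min d (r / 2 - t) by rewrite lt_min d0 subr_gt0.
  have m1 : Num.min d (r / 2 - t) <= d by rewrite ge_min lexx.
  have m2 : Num.min d (r / 2 - t) <= r / 2 - t by rewrite ge_min lexx orbT.
  exists s; split; [by rewrite /s; lra|by rewrite /s; lra|].
  by rewrite /h -mulrBr -incrD; apply: Hd; rewrite /s; split; lra.
(* For this [M] the bound reads [h (r / 2) + 1 <= h (r / 2)]. *)
have := growth ((h (r / 2) + 1) / (r / 2)).
by rewrite mulfVK; [lra|apply: lt0r_neq0; lra].
Qed.

(** The two steep sets and the slope sets with rational [c] and radius [k.+1%:R^-1] form a countable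
    cover. The member with interior is not steep, and a slope set gives uniform constants on its
    interior. *)
Lemma strict_slope_generic eps U : 0 < eps -> fat U ->
  (forall x, U x -> {for x, continuous g}) ->
  exists V, [/\ fat V, V `<=` U & V `<=` strict_slope eps].
Proof.
move=> eps0 fU cg.
pose A (k : bool + rat * nat) : set 'rV[R]_n :=
  match k with
  | inl b => [set x | steep b x]
  | inr ck => [set x | slope eps (ratr ck.1) ck.2.+1%:R^-1 x]
  end.
have [k|x _|k [V [fV VU VA]]] := countable_coverP hD (A := A) _ fU.
- by case: k => [b|ck]; [exact: D_steep|exact: D_slope].
- have [[b]|[c [k]]] := steep_or_slope x eps0; first by exists (inl b).
  by exists (inr (c, k)).
exists V; split=> //; case: k VA => [b|[c k]] VA.
  by have := @steep_not_fat b V fV (fun x Vx => cg x (VU x Vx)) VA.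
move=> x Vx; have [r r0 rV] := fat_sub_ball fV.1 Vx.
have k0 : 0 < k.+1%:R^-1 :> R by rewrite invr_gt0.
exists (Num.min r k.+1%:R^-1); split; first by rewrite lt_min r0.
exists (ratr c) => y xy t [t0 tk]; apply: (VA y).
  apply/rV/ball_rowP; split=> // j; have [] := xy j.
  by rewrite lt_min ltrNl lt_min ltr_norml => /andP[-> _] /andP[+ _]; rewrite ltrNl => ->.
by split=> //; move: tk; rewrite lt_min => /andP[].
Qed.

Lemma strict_slope_weaken eps eps' x :
  eps <= eps' -> strict_slope eps x -> strict_slope eps' x.
Proof.
move=> ee' [d [d0 [c H]]]; exists d; split=> //; exists c => y xy t td.
have [H1 H2] := H y xy t td.
have : eps * t <= eps' * t by rewrite ler_pM2r // (proj1 td).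
by move: H1 H2 => ? ? ?; split; lra.
Qed.

(** To get all [eps] on one open set, the dichotomy is applied to the definable set of strict
    points. Were it empty on [V], failure at a single [k.+1%:R^-1] would fill an open set, against
    [strict_slope_generic]. *)
Lemma strict_generic U : fat U -> (forall x, U x -> {for x, continuous g}) ->
  exists V, [/\ fat V, V `<=` U & forall x, V x ->
    forall eps, 0 < eps -> strict_slope eps x].
Proof.
move=> fU cg; have [V [fV VU [VT|VNT]]] := dichotomyP hD D_strict fU.
  by exists V.
pose A k := ~` [set x | strict_slope k.+1%:R^-1 x].
have [k|x Vx|k [W [fW WV WA]]] := countable_coverP hD (A := A) _ fV.
- by apply: (ominimal_setC hD); exact: D_strict_slope.
- have /existsNP[eps /not_implyP[eps0 Neps]] := VNT _ Vx.
  exists (Num.bound eps^-1) => /(strict_slope_weaken _) Hs; apply/Neps/Hs.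
  rewrite -[leRHS]invrK lef_pV2 ?posrE ?invr_gt0 //.
  by apply/ltW/(lt_trans (archi_boundP _)); rewrite ?invr_ge0 ?ltW // ltr_nat.
have k0 : 0 < k.+1%:R^-1 :> R by rewrite invr_gt0.
have [Y [[_ [y Yy] ] YW Ys]] :=
  strict_slope_generic k0 fW (fun x Wx => cg x (VU x (WV x Wx))).
by have := WA _ (YW _ Yy) (Ys _ Yy).
Qed.

End StrictPartial.

(** * Strict partial derivatives *)

Section MatrixLimits.
Variable R : realType.

Lemma cvg_mx T (F : set_system T) m n (f : T -> 'M[R]_(m, n)) (A : 'M[R]_(m, n)) :
  Filter F -> (forall i j, f t i j @[t --> F] --> A i j) -> f t @[t --> F] --> A.
Proof.
move=> FF H; apply/cvg_ballP => e e0.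
have : \forall t \near F, forall i, forall j, ball (A i j) e (f t i j).
  apply: filter_forall => i; apply: filter_forall => j.
  exact: (cvg_ballP _ _).1 (H i j) _ e0.
by apply: filterS => t Ht; split.
Qed.

Lemma cvg_coord T (F : set_system T) m n (f : T -> 'M[R]_(m, n)) (A : 'M[R]_(m, n)) i j :
  Filter F -> f t @[t --> F] --> A -> f t i j @[t --> F] --> A i j.
Proof.
move=> FF; apply: (@continuous_cvg _ _ _ F FF f (fun M : 'M[R]_(m, n) => M i j)).
exact: coord_continuous.
Qed.

Lemma cvg_mulmx T (F : set_system T) m n p (f : T -> 'M[R]_(m, n)) (g : T -> 'M[R]_(n, p))
    (A : 'M[R]_(m, n)) (B : 'M[R]_(n, p)) :
  Filter F -> f t @[t --> F] --> A -> g t @[t --> F] --> B ->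
  f t *m g t @[t --> F] --> A *m B.
Proof.
move=> FF fA gB; apply: cvg_mx => i j; rewrite mxE.
under eq_fun do rewrite mxE.
apply: (@cvg_big R) => [|k _].
  exact: (@pseudometric_normed_Zmodule.add_continuous R R).
by apply: cvgM; exact: cvg_coord.
Qed.

Lemma cvg_det T (F : set_system T) n (f : T -> 'M[R]_n) (A : 'M[R]_n) :
  Filter F -> f t @[t --> F] --> A -> \det (f t) @[t --> F] --> \det A.
Proof.
move=> FF fA; apply: (@cvg_big R) => [|s _].
  exact: (@pseudometric_normed_Zmodule.add_continuous R R).
apply: cvgM; first exact: cvg_cst.
apply: (@cvg_big R) => [|k _]; first exact: mul_continuous.
exact: cvg_coord.
Qed.

End MatrixLimits.

(** * From strict partial derivatives to class C1 *)

Section StrictDerivative.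
Variable R : realType.

Section OneVariable.
Variables (n : nat) (g : 'rV[R]_n -> R) (i : 'I_n).

Definition strict_partial (p : R) (x : 'rV[R]_n) := forall eps, 0 < eps ->
  exists2 d, 0 < d & forall y t, ball x d y -> `|t| < d ->
    `|incr g i y t - p * t| <= eps * `|t|.

(** Both bounds are compared at one small [t]. Hence the intervals from [c - eps] to [c + eps]
    overlap pairwise, and the supremum of their left ends lies in all of them. *)
Lemma slope_unique eps eps' c c' d d' x : 0 < d -> 0 < d' ->
  slope g i eps c d x -> slope g i eps' c' d' x -> c - eps <= c' + eps'.
Proof.
move=> d0 d'0 H H'; pose t := Num.min d d' / 2.
have m0 : 0 < Num.min d d' by rewrite lt_min d0.
have m1 : Num.min d d' <= d by rewrite ge_min lexx.
have m2 : Num.min d d' <= d' by rewrite ge_min lexx orbT.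
have t0 : 0 < t by rewrite /t; lra.
have [|_ H1] := H t; first by split=> //; rewrite /t; lra.
have [|H2 _] := H' t; first by split=> //; rewrite /t; lra.
by rewrite -(ler_pM2r t0) mulrBl mulrDl; lra.
Qed.

Lemma strict_slope_partial x :
  (forall eps, 0 < eps -> strict_slope g i eps x) -> exists p, strict_partial p x.
Proof.
move=> H; pose S := [set a | exists eps c d, [/\ 0 < eps, 0 < d, slope g i eps c d x
  & a = c - eps]].
have self d : 0 < d -> forall j, x ord0 j - x ord0 j < d /\ - d < x ord0 j - x ord0 j.
  by move=> d0 j; rewrite subrr oppr_lt0.
have ubS eps c d : 0 < d -> slope g i eps c d x -> ubound S (c + eps).
  by move=> d0 sl _ [eps' [c' [d' [_ d'0 sl' ->]]]]; exact: slope_unique sl' sl.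
have supS : has_sup S.
  have [d [d0 [c Hc]]] := H 1 ltr01; have sl := Hc x (self d d0).
  by split; [exists (c - 1), 1, c, d|exists (c + 1); exact: ubS sl].
exists (sup S) => eps eps0; have eps20 : 0 < eps / 2 by lra.
have [d [d0 [c Hc]]] := H _ eps20; have sl := Hc x (self d d0).
have cp : c - eps / 2 <= sup S.
  by apply: ub_le_sup; [case: supS|exists (eps / 2), c, d].
have pc : sup S <= c + eps / 2 by apply: ge_sup; [case: supS|exact: ubS sl].
set p := sup S in cp pc *.
have fwd y t : ball x d y -> 0 < t < d -> `|incr g i y t - p * t| <= eps * t.
  move=> /ball_rowP[_ xy] /andP[t0 td].
  have [||H1 H2] := Hc y _ t _.
    by move=> j; have := xy j; rewrite ltr_norml => /andP[].
    by [].
  have : (c - eps / 2) * t <= p * t by rewrite ler_pM2r.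
  have : p * t <= (c + eps / 2) * t by rewrite ler_pM2r.
  by rewrite mulrBl mulrDl ler_norml => ? ?; apply/andP; split; lra.
(* A backward step from [y] is a forward step from [y + t *: delta_mx ord0 i]; halving the radius
   keeps that point in the ball of radius [d]. *)
exists (d / 2); first lra.
move=> y t xy td.
have xdy : ball x d y by apply: le_ball xy; lra.
have [t0|t0|->] := ltgtP t 0; last first.
- by rewrite /incr scale0r addr0 subrr mulr0 subrr normr0 mulr0.
- move: td; rewrite (gtr0_norm t0) => td.
  by apply: fwd => //; rewrite t0; lra.
rewrite (ltr0_norm t0) in td *.
have yt : ball x d (y + t *: delta_mx ord0 i).
  have -> : d = d / 2 + d / 2 by lra.
  apply: ball_triangle xy _; apply/ball_rowP; split=> [|j]; first lra.
  rewrite !mxE opprD addNKr normrN normrM (ltr0_norm t0).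
  by case: (_ && _); rewrite ?normr1 ?normr0; lra.
have tdd : 0 < - t < d by rewrite oppr_gt0 t0 /=; lra.
have := fwd _ _ yt tdd.
suff -> : incr g i y t - p * t =
    - (incr g i (y + t *: delta_mx ord0 i) (- t) - p * - t) by rewrite normrN.
by rewrite /incr scaleNr addrK; ring.
Qed.

(** Strictness at [x] also controls the increments based at [y], so [p] and [p'] approximate the
    same difference quotient; this is the continuity of partial derivatives. *)
Lemma strict_partial_close eps x p : 0 < eps -> strict_partial p x ->
  \forall y \near x, forall p', strict_partial p' y -> `|p' - p| <= eps.
Proof.
move=> eps0 H; have eps20 : 0 < eps / 2 by lra.
have [d d0 Hd] := H _ eps20; apply/nbhs_ballP; exists d => //= y xy p' H'.
have [d' d'0 Hd'] := H' _ eps20.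
pose t := Num.min d d' / 2.
have m0 : 0 < Num.min d d' by rewrite lt_min d0.
have m1 : Num.min d d' <= d by rewrite ge_min lexx.
have m2 : Num.min d d' <= d' by rewrite ge_min lexx orbT.
have t0 : 0 < t by rewrite /t; lra.
have tE : `|t| = t by rewrite gtr0_norm.
have td : `|t| < d by rewrite tE /t; lra.
have td' : `|t| < d' by rewrite tE /t; lra.
have H1 := Hd' y t (ballxx _ d'0) td'; have H2 := Hd y t xy td; rewrite tE in H1 H2.
 rewrite -(ler_pM2r t0) -{1}tE -normrM mulrBl.
by move: H1 H2; rewrite !ler_norml => /andP[? ?] /andP[? ?]; apply/andP; split; lra.
Qed.

End OneVariable.

Lemma ler_norm_coord n (h : 'rV[R]_n) i : `|h ord0 i| <= `|h|.
Proof.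
by rewrite [leRHS]/Num.norm /= mx_normrE; apply/bigmax_geP; right => /=; exists (ord0, i).
Qed.

Lemma ler_norm_row n (v : 'rV[R]_n) c :
  0 <= c -> (forall i, `|v ord0 i| <= c) -> `|v| <= c.
Proof.
move=> c0 vc; rewrite [leLHS]/Num.norm /= mx_normrE; apply/bigmax_leP; split=> //.
by move=> [j i] _ /=; rewrite ord1.
Qed.

(** The increment [h] is split into [n] steps along the axes; strictness allows their base points to
    differ from [x]. *)
Lemma strict_partial_diff m n (f : 'rV[R]_n -> 'rV[R]_m) (A : 'M[R]_(n, m)) x :
  (forall i j, strict_partial (fun y => f y ord0 j) i (A i j) x) ->
  differentiable f x /\ jacobian f x = A.
Proof.
move=> H; have cA : continuous (mulmxr A : 'rV[R]_n -> 'rV[R]_m).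
  move=> y; apply: (@cvg_mulmx _ _ (nbhs y) _ _ _ id (fun=> A) y A).
    exact: cvg_id.
  exact: cvg_cst.
have lo : f \o shift x = cst (f x) + (mulmxr A : 'rV[R]_n -> 'rV[R]_m) +o_ 0 id.
  (* Each of the [n] steps costs at most [e] times the norm of [h]; the successor keeps the
     denominator nonzero for [n = 0]. *)
  apply/eqaddoP => eps eps0; pose e := eps / n.+1%:R.
  have e0 : 0 < e by rewrite divr_gt0.
  have [d [d0 Hd]] : exists d, 0 < d /\ forall i j y t, ball x d y -> `|t| < d ->
      `|incr (fun y => f y ord0 j) i y t - A i j * t| <= e * `|t|.
    have : \forall d \near (0 : R)^'+, forall i j y t, ball x d y ->
        `|t| < d -> `|incr (fun y => f y ord0 j) i y t - A i j * t| <= e * `|t|.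
      apply: filter_forall => i; apply: filter_forall => j.
      have [d d0 Hd] := H i j e e0; near=> d' => y t xy td.
      have d'd : d' <= d by near: d'; exact: nbhs_right_le.
      by apply: Hd; [exact: le_ball xy|exact: lt_le_trans td _].
    move=> /(filterI (nbhs_right_gt (0 : R)))/filter_ex[d [d0 Hd] ].
    by exists d.
  apply/nbhs_ballP; exists d => //= h /ball_rowP[_ hd].
  have {}hd i : `|h ord0 i| < d by have := hd i; rewrite mxE sub0r normrN.
  pose hk k : 'rV[R]_n := \row_i if (i < k)%N then h ord0 i else 0.
  have hkS (k : 'I_n) : hk k.+1 = hk k + h ord0 k *: delta_mx ord0 k.
    apply/rowP => i; rewrite !mxE eqxx /= ltnS leq_eqVlt.
    have [/eqP/val_inj ->|ik] := boolP (val i == val k).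
      by rewrite ltnn eqxx mulr1 add0r.
    by rewrite -val_eqE (negPf ik) mulr0 addr0.
  have claim j k : (k <= n)%N ->
      `|f (x + hk k) ord0 j - f x ord0 j - (hk k *m A) ord0 j| <= k%:R * (e * `|h|).
    elim: k => [|k IHk] kn.
      rewrite (_ : hk 0%N = 0) ?addr0 ?mul0mx ?mxE ?subrr ?normr0 ?mul0r ?subr0 //.
      by apply/rowP => i; rewrite !mxE.
    have {}IHk := IHk (ltnW kn); have -> := hkS (Ordinal kn).
    set y := x + hk k; have xy : ball x d y.
      apply/ball_rowP; split=> // i; rewrite /y !mxE opprD addNKr normrN.
      by case: ifP; rewrite ?normr0.
    have := Hd (Ordinal kn) j y _ xy (hd (Ordinal kn)).
    move=> /le_trans/(_ (ler_wpM2l (ltW e0) (ler_norm_coord h (Ordinal kn)))) step.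
    rewrite -natr1 mulrDl mul1r; apply: le_trans (lerD IHk step).
    apply: le_trans (ler_normD _ _); rewrite le_eqVlt; apply/orP/or_introl/eqP.
    by congr (`|_|); rewrite /incr mulmxDl -scalemxAl -rowE !mxE addrA -/y /=; ring.
  apply: ler_norm_row => [|j].
    by rewrite mulr_ge0 // ltW.
  have hn : hk n = h by apply/rowP => i; rewrite mxE ltn_ord.
  rewrite [X in `|X|](_ : _ = f (x + h) ord0 j - f x ord0 j - (h *m A) ord0 j).
    have := claim j n (leqnn n); rewrite hn => /le_trans; apply.
    rewrite mulrA ler_wpM2r //.
    by rewrite /e mulrCA ger_pMr // ler_pdivrMr // mul1r ler_nat.
  by rewrite (addrC x h) -addrA -opprD [LHS]mxE [X in _ + X = _]mxE [X in _ - X = _]mxE.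
have dfE := diff_unique cA lo; split.
  by apply/diff_locallyP; rewrite dfE.
apply/matrixP => i j; rewrite /jacobian mxE.
by rewrite -[LHS]/(('d f x : _ -> _) (delta_mx ord0 i) ord0 j) dfE /= -rowE mxE.
Unshelve. all: by end_near. Qed.

Lemma strict_partial_C1 m n (f : 'rV[R]_n -> 'rV[R]_m) (J : 'rV[R]_n -> 'M[R]_(n, m)) V :
  open V ->
  (forall x, V x -> forall i j, strict_partial (fun y => f y ord0 j) i (J x i j) x) ->
  forall x, V x -> differentiable f x /\ {for x, continuous (jacobian f)}.
Proof.
move=> oV H x Vx; have [df Jx] := strict_partial_diff (H x Vx); split=> //.
apply: (@cvg_mx _ _ (nbhs x)) => i j; apply/cvgrPdist_le => e e0; rewrite Jx.
have Vnx : \forall y \near x, V y by exact: open_nbhs_nbhs.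
near=> y; have Vy : V y by near: y.
have [_ Jy] := strict_partial_diff (H y Vy).
rewrite -/(jacobian f y) Jy distrC.
have := H y Vy i j; near: y.
by apply: filterS (strict_partial_close e0 (H x Vx i j)) => y; apply.
Unshelve. all: by end_near. Qed.

End StrictDerivative.

(** * The sign of the Jacobian determinant *)

Section GenericSmoothness.
Variables (R : realType) (D : forall n : nat, set (set 'rV[R]_n)).
Arguments D : clear implicits.
Hypothesis hD : ominimal D.
Variables (n : nat) (Omega : set 'rV[R]_n) (f : 'rV[R]_n -> 'rV[R]_n).
Hypothesis hopen : open Omega.
Hypothesis hcont : {within closure Omega, continuous f}.
Hypothesis hf : definable_map D (closure Omega) f.

(** Definability of [f] concerns only the closure of [Omega]; the extension by 0 gives a definable
    function on the whole space. *)
Definition component (j : 'I_n) (x : 'rV[R]_n) : R :=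
  if pselect (closure Omega x) then f x ord0 j else 0.

Lemma dfun_component j : dfun D (component j).
Proof.
pose G := [set row_mx x (f x) | x in closure Omega].
have GP x w : G (row_mx x w) <-> closure Omega x /\ w = f x.
  split=> [[y cy /eq_row_mx[<- <-]]//|[cx ->]]; by exists x.
rewrite /dfun /dterm; apply: (@dpred_iff _ _ (fun e =>
    (exists w, G (row_mx (trunc n (fun k => e k.+1)) w) /\ e 0%N = w ord0 j) \/
    (~ (exists w, G (row_mx (trunc n (fun k => e k.+1)) w)) /\ e 0%N = 0))).
  move=> e; rewrite /component; set x := trunc _ _; case: pselect => cx.
    split=> [[[w [/GP[_ ->]]]//|[H]]|->].
      by case: H; exists (f x); apply/GP.
    by left; exists (f x); split=> //; apply/GP.
  split=> [[[w [/GP[]]]//|[]]//|->]; right; split=> // -[w /GP[]//].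
have dG (v w : (nat -> R) -> 'rV[R]_n) : dvec D v -> dvec D w ->
    dpred D (fun e => G (row_mx (v e) (w e))).
  by move=> dv dw; apply: (dpred_mem hD hf); exact: dvec_row.
apply: (dpred_or hD).
  apply: (dpred_exv hD); apply: (dpred_and hD).
    by apply: dG; [exact: (dvec_trunc hD)|exact: (dvec_trunc hD id)].
  apply: (dpred_eq hD); first exact: dterm_var.
  exact: (dvec_trunc hD id).
apply: (dpred_and hD); last by apply: (dpred_eq hD); [exact: dterm_var|exact: dterm_cst].
apply: (dpred_not hD); apply: (dpred_exv hD).
by apply: dG; [exact: (dvec_trunc hD)|exact: (dvec_trunc hD id)].
Qed.

Lemma component_eq j x : Omega x -> component j x = f x ord0 j.
Proof.
by move=> Ox; rewrite /component; case: pselect => // -[]; exact: subset_closure.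
Qed.

Lemma component_continuous j x : Omega x -> {for x, continuous (component j)}.
Proof.
move=> Ox.
have fx : {for x, continuous f}.
  have := continuous_subspaceW (@subset_closure _ Omega) hcont.
  by rewrite (continuous_open_subspace _ hopen); apply; rewrite inE.
have nOx : \forall y \near x, Omega y by exact: open_nbhs_nbhs.
have fj : f y ord0 j @[y --> x] --> f x ord0 j by apply: (@cvg_coord _ _ (nbhs x)).
rewrite /prop_for /continuous_at component_eq //; apply: cvg_trans fj.
apply: (@near_eq_cvg _ _ (nbhs x)); near=> y; rewrite component_eq //; near: y.
exact: nOx.
Unshelve. all: by end_near. Qed.

Lemma strict_partial_local (g h : 'rV[R]_n -> R) i p x V : open V -> V x ->
  (forall y, V y -> g y = h y) -> strict_partial g i p x -> strict_partial h i p x.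
Proof.
move=> oV Vx gh H eps /H[d d0 Hd]; have [r r0 rV] := fat_sub_ball oV Vx.
(* Both [y] and [y + t *: delta_mx ord0 i] have to stay in the ball of radius [r]. *)
exists (Num.min d (r / 2)); first by rewrite lt_min d0; lra.
move=> y t xy; rewrite lt_min => /andP[td tr].
have xdy : ball x d y by apply: le_ball xy; rewrite ge_min lexx.
have xry : ball x (r / 2) y by apply: le_ball xy; rewrite ge_min lexx orbT.
have := Hd y t xdy td; rewrite /incr !gh //.
  by apply: rV; apply: le_ball xry; lra.
apply: rV; rewrite [r]splitr; apply: ball_triangle xry _.
apply/ball_rowP; split=> [|j]; first lra.
rewrite !mxE opprD addNKr normrN normrM.
by case: (_ && _); rewrite ?normr1 ?normr0; lra.
Qed.

Lemma strict_generic_all (s : seq ('I_n * 'I_n)) U : fat U -> U `<=` Omega ->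
  exists V, [/\ fat V, V `<=` U & forall ij, ij \in s -> forall x, V x ->
    forall eps, 0 < eps -> strict_slope (component ij.2) ij.1 eps x].
Proof.
move=> fU UO; elim: s => [|ij s [V [fV VU HV] ] ]; first by exists U; split.
have [|W [fW WV HW] ] := strict_generic hD ij.1 (dfun_component ij.2) fV.
  by move=> x /VU/UO; exact: component_continuous.
exists W; split=> //; first exact: subset_trans VU.
move=> kl; rewrite in_cons => /orP[/eqP ->|ks] x Wx; first exact: HW.
by apply: HV => //; exact: WV.
Qed.

(** Shrinking [U] once for each pair of an axis and a component gives an open set where all partial
    derivatives are strict. The density obtained here makes the filter in [Sign] proper. *)
Lemma smooth_dense U : fat U -> U `<=` Omega ->
  exists2 x, U x & (Omega `\` Bset Omega f) x.
Proof.
move=> fU UO; have [V [[oV [x Vx] ] VU HV] ] := strict_generic_all (enum predT) fU UO.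
have HP y ij : exists p, V y -> strict_partial (component ij.2) ij.1 p y.
  have [Vy|NVy] := pselect (V y); last by exists 0.
  have [|p Hp] := @strict_slope_partial _ _ (component ij.2) ij.1 y; last by exists p.
  by apply: HV => //; rewrite mem_enum.
have /choice[J HJ] : forall y, exists A : 'M[R]_n, V y ->
    forall i j, strict_partial (fun z => f z ord0 j) i (A i j) y.
  move=> y; have /choice[p Hp] := HP y.
  exists (\matrix_(i, j) p (i, j)) => Vy i j; rewrite mxE.
  apply: (strict_partial_local oV Vy _ (Hp (i, j) Vy)).
  by move=> z /VU/UO; exact: component_eq.
exists x; first exact: VU.
split; first by apply/UO/VU.
move=> [_]; apply; have := open_nbhs_nbhs (conj oV Vx).
by apply: filterS => y Vy; exact: strict_partial_C1 oV HJ y Vy.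
Qed.

End GenericSmoothness.

(** * Euclidean balls and nonvanishing determinants *)

Section Nondegenerate.
Variables (R : realType) (n : nat).
Implicit Types (v x y : 'rV[R]_n) (A B : 'M[R]_n).

Lemma ler_coord_enorm v i : `|v ord0 i| <= enorm v.
Proof.
rewrite -sqrtr_sqr /enorm ler_wsqrtr // (bigD1 i) //= lerDl.
by apply: sumr_ge0 => j _; exact: sqr_ge0.
Qed.

Lemma enormZ c v : enorm (c *: v) = `|c| * enorm v.
Proof.
rewrite /enorm -sqrtr_sqr -sqrtrM ?sqr_ge0 // mulr_sumr.
by congr Num.sqrt; apply: eq_bigr => i _; rewrite mxE exprMn.
Qed.

Lemma enorm0 : enorm (0 : 'rV[R]_n) = 0.
Proof. by rewrite -(scale0r 0) enormZ normr0 mul0r. Qed.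

Lemma enorm_continuous : continuous (@enorm R n).
Proof.
move=> v; apply: (@continuous_cvg _ _ _ (nbhs v) _
  (fun w => \sum_i w ord0 i ^+ 2) Num.sqrt).
  exact: sqrt_continuous.
apply: (@cvg_big R _ _ _ _ _ _ (nbhs v)) => [|i _].
  exact: (@pseudometric_normed_Zmodule.add_continuous R R).
have wi := @coord_continuous R 1 n ord0 i v.
exact: (cvgM wi wi).
Qed.

Lemma open_eball x r : open (eball x r).
Proof.
rewrite openE => y yr; rewrite /interior.
have c : enorm (z - x) @[z --> y] --> enorm (y - x).
  apply: (@continuous_cvg _ _ _ (nbhs y) _ (fun z => z - x) (@enorm R n)).
    exact: enorm_continuous.
  by apply: cvgB; [exact: cvg_id|exact: cvg_cst].
exact: (cvgr_lt _ c _ yr).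
Qed.

Lemma eball_center x r : 0 < r -> eball x r x.
Proof. by rewrite /eball /= subrr enorm0. Qed.

Lemma eball_sub_ball x r : 0 < r -> eball x r `<=` ball x r.
Proof.
move=> r0 y yr; apply/ball_rowP; split=> // i.
apply: le_lt_trans yr; rewrite distrC.
by have := ler_coord_enorm (y - x) i; rewrite !mxE.
Qed.

Lemma eball_in_open (U : set 'rV[R]_n) x : open U -> U x ->
  exists2 r, 0 < r & eball x r `<=` U.
Proof.
move=> oU Ux; have [r r0 rU] := fat_sub_ball oU Ux.
by exists r => // y /(eball_sub_ball r0)/rU.
Qed.

(** A nonzero kernel vector, scaled to Euclidean norm 1, would bring the infimum down to 0. *)
Lemma sigma_gt0_det A : (0 < sigma A)%E -> \det A != 0.
Proof.
apply: contraL => /det0P[v v0 vA]; rewrite -leNgt.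
have ev0 : enorm v != 0.
  apply: contraNneq v0 => ev; apply/eqP/rowP => i; apply/eqP.
  by rewrite mxE -normr_le0 -ev ler_coord_enorm.
apply: ereal_inf_lbound; exists ((enorm v)^-1 *: v).
  by rewrite /= enormZ ger0_norm ?invr_ge0 ?sqrtr_ge0 // mulVf.
by rewrite -scalemxAl vA scaler0 enorm0.
Qed.

Lemma convex_hull_segment (S : set 'M[R]_n) A B l : S A -> S B -> 0 <= l <= 1 ->
  convex_hull S (l *: A + (1 - l) *: B).
Proof.
move=> SA SB /andP[l0 l1] C [cC SC].
have := cC A B (Itv01 l0 l1); rewrite !inE => /(_ (SC _ SA) (SC _ SB)).
by [].
Qed.

Lemma sgr_det_segment A B :
  (forall l, 0 <= l <= 1 -> \det (l *: A + (1 - l) *: B) != 0) ->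
  Num.sg (\det A) = Num.sg (\det B).
Proof.
move=> H; pose h l := \det (l *: A + (1 - l) *: B).
have h1 : h 1 = \det A by rewrite /h scale1r subrr scale0r addr0.
have h0 : h 0 = \det B by rewrite /h scale0r add0r subr0 scale1r.
have ch : {within `[0, 1], continuous h}.
  apply: continuous_subspaceT => l; apply: cvg_det; apply: cvgD.
    by apply: cvgZ; [exact: cvg_id|exact: cvg_cst].
  by apply: cvgZ; [apply: cvgB; [exact: cvg_cst|exact: cvg_id]|exact: cvg_cst].
have hn0 l : 0 <= l <= 1 -> h l != 0 by exact: H.
have hA : h 1 != 0 by apply: hn0; rewrite ler01 lexx.
have hB : h 0 != 0 by apply: hn0; rewrite ler01 lexx.
have := IVT ler01 ch (v := 0); rewrite -h1 -h0.
(* If 0 lay between the end values, [h] would vanish on the segment; otherwise both ends lie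
   strictly on the same side of 0. *)
have [zero IVTh|nzero _] := boolP (Num.min (h 0) (h 1) <= 0 <= Num.max (h 0) (h 1)).
  by have [//|l] := IVTh; rewrite in_itv /= => /hn0/eqP.
move: nzero; rewrite ge_min le_max negb_and !negb_or -!ltNge.
by move=> /orP[] /andP[a b]; [rewrite !gtr0_sg|rewrite !ltr0_sg].
Qed.

End Nondegenerate.

(** * Regularity witnessed by a single radius *)

Section RegularPoints.
Variables (R : realType) (n : nat) (Omega : set 'rV[R]_n) (f : 'rV[R]_n -> 'rV[R]_n).
Implicit Types x : 'rV[R]_n.

Definition hull_gap x (r : R) : \bar R :=
  ereal_inf (@sigma R n @` convex_hull (dset Omega f (eball x r))).

(** A smaller ball has fewer derivatives, hence a smaller hull and a larger infimum. *)
Lemma hull_gap_sub x y r s :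
  eball y s `<=` eball x r -> (hull_gap x r <= hull_gap y s)%E.
Proof.
move=> yx; apply: ereal_inf_le_tmp => _ [A HA <-]; exists A => //.
by move=> C [cC SC]; apply: HA; split=> // _ [z [yz Hz] <-]; apply: SC;
   exists z => //; split=> //; exact: yx.
Qed.

(** The gap is nonincreasing in the radius, so its limit at 0 from the right is a supremum. *)
Lemma nu_sup x : nu Omega f x = ereal_sup (hull_gap x @` `]0, +oo[).
Proof.
apply: cvg_lim; first exact: ereal_hausdorff.
apply: (nonincreasing_at_right_cvge +oo%O) => // r s _ _ rs.
by apply: hull_gap_sub => y /lt_le_trans; apply.
Qed.

Lemma nu_gt0 x : (0 < nu Omega f x)%E <-> exists2 r, 0 < r & (0 < hull_gap x r)%E.
Proof.
rewrite nu_sup; split=> [/ereal_sup_gt[_ [r /= + <-] ]|[r r0 /lt_le_trans]].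
  by rewrite in_itv /= andbT => r0 gr; exists r.
by apply; apply: ereal_sup_ubound; exists r => //=; rewrite in_itv /= r0.
Qed.

Lemma sgr_det_hull_gap x r A B : (0 < hull_gap x r)%E ->
  dset Omega f (eball x r) A -> dset Omega f (eball x r) B ->
  Num.sg (\det A) = Num.sg (\det B).
Proof.
move=> g0 SA SB; apply: sgr_det_segment => l l01; apply: sigma_gt0_det.
apply: lt_le_trans g0 _; apply: ereal_inf_lbound.
by exists (l *: A + (1 - l) *: B) => //; exact: convex_hull_segment.
Qed.

End RegularPoints.

Unset Implicit Arguments.

Theorem lemma5p1 (R : realType) (D : forall n : nat, set (set 'rV[R]_n))
    (hD : ominimal D) (n : nat)
    (Omega : set 'rV[R]_n) (hopen : open Omega) (hbounded : bounded_set Omega)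
    (hOmega : D n Omega)
    (f : 'rV[R]_n -> 'rV[R]_n)
    (hcont : {within closure Omega, continuous f})
    (hf : definable_map D (closure Omega) f)
    (xbar : 'rV[R]_n) (hxbar : Omega xbar)
    (hreg : regular_point Omega f xbar) :
  exists r : R, [/\ 0 < r,
    eball xbar r `<=` Omega,
    forall x, eball xbar r x -> regular_point Omega f x
    & forall x, eball xbar r x -> Sign Omega f x = Sign Omega f xbar].
Proof.
have [_ /nu_gt0[r1 r10 gap1] ] := hreg.
have [r2 r20 sub2] := eball_in_open hopen hxbar.
pose r := Num.min r1 r2; have r0 : 0 < r by rewrite lt_min r10.
have gap : (0 < hull_gap Omega f xbar r)%E.
  apply: lt_le_trans gap1 _; apply: hull_gap_sub => y /lt_le_trans; apply.
  by rewrite ge_min lexx.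
have subO : eball xbar r `<=` Omega.
  by move=> y /lt_le_trans yr; apply/sub2/yr; rewrite ge_min lexx orbT.
have dense U x : open U -> U x -> Omega x ->
    exists2 y, U y & (Omega `\` Bset Omega f) y.
  move=> oU Ux Ox; have [||y [Uy _] Hy] :=
    @smooth_dense R D hD n Omega f hopen hcont hf (U `&` Omega); last by exists y.
    by split; [exact: openI|exists x].
  by move=> y [].
(* One smooth point of the ball serves as the reference for all signs. *)
have [y0 yr0 Hy0] :=
  dense _ _ (@open_eball R n xbar r) (@eball_center R n xbar r r0) hxbar.
have SignE x : eball xbar r x -> Sign Omega f x = Num.sg (\det (jacobian f y0)).
  move=> xr; have Ox := subO _ xr.
  (* By density every neighbourhood of [x] meets the smooth points; a function eventually constant
     along this proper filter has that constant as its limit. *)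
  have FF : ProperFilter (within (Omega `\` Bset Omega f) (nbhs x)).
    apply: Build_ProperFilter_ex => P; rewrite /within nbhsE => -[U [oU Ux] UP].
    by have [y Uy Hy] := dense _ _ oU Ux Ox; exists y; exact: UP.
  apply: norm_lim_near_cst; rewrite near_withinE.
  have : nbhs x (eball xbar r) by apply: open_nbhs_nbhs; split=> //; exact: open_eball.
  apply: filterS => y yr Hy; apply: (sgr_det_hull_gap gap).
    by exists y.
  by exists y0.
exists r; split; [exact: r0|exact: subO| |]; last first.
  by move=> x xr; rewrite (SignE x xr) (SignE xbar (@eball_center R n xbar r r0)).
move=> x xr; split; first exact: subO.
(* A ball around [x] inside the ball around [xbar] inherits its positive gap. *)
have [s s0 sx] := eball_in_open (@open_eball R n xbar r) xr.
by apply/nu_gt0; exists s => //; apply: lt_le_trans gap _; exact: hull_gap_sub.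
Qed.
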